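(* Let $(\Omega,\mathcal{F},P)$ be a probability space and $T:\Omega\to\Omega$ be a measurable invertible transformation ($P$ need not be $T$-invariant). Suppose that the limit $$\lim_{N\to\infty}\frac1N\sum_{i=0}^{N-1}P(T^{-i}A)$$ exists for each $A\in\mathcal{F}$. Let $\mathcal{I}=\{A\in\mathcal{F}:T^{-1}A=A\}$ and $P(\mathcal{I})=\{P(A):A\in\mathcal{I}\}$. Then the following statements are equivalent: (i) $\#(P(\mathcal{I}))<\infty$; (ii) $(\Omega,\mathcal{F},P,T)$ satisfies the finite irreducible invariant set partition assumption; (iii) there exist $Q_1,\ldots,Q_n\in\mathcal{M}^e(T)$ and a finite measurable partition $\alpha=\{A_1,\ldots,A_n\}$ of $\Omega$ with $P(A_i)>0$, $i=1,2,\ldots,n$, such that for any bounded $\mathcal{F}$-measurable function $f$, $$\lim_{N\to\infty}\frac1N\sum_{i=0}^{N-1}f\circ T^i=\sum_{j=1}^n\Big(\int f\,dQ_j\Big)\cdot1_{A_j},\quad P\text{-a.s.};$$ (iv) there exist $Q_1,\ldots,Q_n\in\mathcal{M}^e(T)$ and a finite measurable partition $\alpha=\{A_1,\ldots,A_n\}$ of $\Omega$ with $P(A_i)>0$, $i=1,2,\ldots,n$, such that $$\lim_{N\to\infty}\frac1N\sum_{i=0}^{N-1}P(B\cap T^{-i}C)=\sum_{j=1}^nQ_j(C)P(A_j\cap B)\quad\text{for any }B,C\in\mathcal{F}.$$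
   Context: $\#(F)$ denotes the cardinality of a set $F$. ''Invertible'' means $T$ is a bijection with measurable inverse. $\mathcal{M}^e(T)$ is the set of all $T$-invariant ergodic probabilities on $(\Omega,\mathcal{F})$. A measurable partition $\alpha$ of $\Omega$ is a finite irreducible invariant set partition (with respect to $P$ and $T$) if $\#(\alpha)<\infty$ and for every $A\in\alpha$: (a) $P(A)>0$; (b) $A\in\mathcal{I}$; (c) there is no $T$-invariant set $B\in\mathcal{I}$, $B\subset A$, with $0<P(B)<P(A)$. $(\Omega,\mathcal{F},P,T)$ satisfies the finite irreducible invariant set partition assumption if such a partition exists. *)

(* Defs.v *)
From HB Require Import structures.
From mathcomp Require Import all_boot all_order all_algebra.
From mathcomp Require Import all_classical all_reals all_analysis.

Set Implicit Arguments.
Unset Strict Implicit.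
Unset Printing Implicit Defensive.

Import Order.TTheory GRing.Theory Num.Theory.
Import numFieldNormedType.Exports.

Local Open Scope classical_set_scope.
Local Open Scope ring_scope.

Definition invertible_transformation (d : measure_display)
    (Omega : measurableType d) (T : Omega -> Omega) : Prop :=
  exists S : Omega -> Omega,
    [/\ cancel T S, cancel S T & measurable_fun [set: Omega] S].

Definition invariant_sets (d : measure_display) (Omega : measurableType d)
    (T : Omega -> Omega) : set (set Omega) :=
  [set A | measurable A /\ T @^-1` A = A].

Definition invariant_probability (d : measure_display) (R : realType)
    (Omega : measurableType d) (T : Omega -> Omega)
    (Q : probability Omega R) : Prop :=
  forall A, measurable A -> Q (T @^-1` A) = Q A.

Definition ergodic_probabilities (d : measure_display) (R : realType)
    (Omega : measurableType d) (T : Omega -> Omega) :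
    set (probability Omega R) :=
  [set Q | invariant_probability T Q /\
    forall A, invariant_sets T A -> Q A = 0%E \/ Q A = 1%E].

(* The value at N = 0 is 0 by the convention 0^-1 = 0. *)
Definition cesaro_mean (R : realType) (u : R^nat) : R^nat :=
  fun N => N%:R^-1 * \sum_(0 <= i < N) u i.

(* Partitions are exact, not up to null sets: the blocks are pairwise disjoint
   and nonempty, and their union is the whole space. *)
Definition finite_irreducible_invariant_partition (d : measure_display)
    (R : realType) (Omega : measurableType d) (P : probability Omega R)
    (T : Omega -> Omega) (alpha : set (set Omega)) : Prop :=
  [/\ classical_sets.partition alpha id [set: Omega],
      finite_set alpha &
      forall A, alpha A ->
        [/\ (0 < P A)%E,
            invariant_sets T A &
            ~ exists B, [/\ invariant_sets T B, B `<=` A & (0 < P B < P A)%E]]].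

Definition finite_irreducible_invariant_partition_assumption
    (d : measure_display) (R : realType) (Omega : measurableType d)
    (P : probability Omega R) (T : Omega -> Omega) : Prop :=
  exists alpha, finite_irreducible_invariant_partition P T alpha.

Definition measurable_partition (d : measure_display)
    (Omega : measurableType d) (n : nat) (A : 'I_n -> set Omega) : Prop :=
  classical_sets.partition [set: 'I_n] A [set: Omega] /\
  forall j, measurable (A j).

(* Main.v *)
(* The Cesaro means of P o T^-i are probabilities converging setwise, so by
   Nikodym's convergence theorem their limit mu is a T-invariant probability,
   and mu = P on invariant sets. Conditioning mu on an irreducible block A_j
   gives an ergodic Q_j. Birkhoff's theorem for Q_j has an exceptional set which
   can be taken strictly invariant, so being Q_j-null it is P-null inside A_j:
   this is (iii). Integrating (iii) gives (iv), and for C invariant (iv) reads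
   P(C) = sum of Q_j(C) P(A_j) with Q_j(C) in {0, 1}, hence (i). Under (i), a
   reducible block can be split only finitely often, since each part takes
   strictly fewer values on its invariant subsets. *)

Require Import Defs.
From HB Require Import structures.
From mathcomp Require Import all_boot all_order all_algebra.
From mathcomp Require Import all_classical all_reals all_analysis.
From mathcomp Require finmap.
From mathcomp Require Import measurable_realfun lra.

Set Implicit Arguments.
Unset Strict Implicit.
Unset Printing Implicit Defensive.

Import Order.TTheory GRing.Theory Num.Theory.
Import numFieldNormedType.Exports.

Local Open Scope classical_set_scope.
Local Open Scope ring_scope.

(* Countable additivity, encoded as finite additivity together with continuity
   at the empty set. *)
Definition real_measure (R : realType) (d : measure_display)
    (Omega : measurableType d) (m : set Omega -> R) : Prop :=
  [/\ forall A, measurable A -> 0 <= m A,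
      forall A B, measurable A -> measurable B -> A `&` B = set0 ->
        m (A `|` B) = m A + m B &
      forall A : (set Omega)^nat, (forall n, measurable (A n)) ->
        (forall n, A n.+1 `<=` A n) -> \bigcap_n A n = set0 ->
        m \o A @ \oo --> 0].

(** * Finite real-valued measures, their setwise limits, and the passage to probabilities *)

Section real_measure_theory.
Context (R : realType) (d : measure_display) (Omega : measurableType d).
Implicit Types (m : set Omega -> R) (A B : set Omega).

Lemma real_measure0 m : real_measure m -> m set0 = 0.
Proof.
by move=> [_ mU _]; have := mU set0 set0 measurable0 measurable0 (setI0 _);
  rewrite setU0; lra.
Qed.

Lemma real_measureD m A B : real_measure m -> measurable A -> measurable B ->
  A `<=` B -> m (B `\` A) = m B - m A.
Proof.
move=> [_ mU _] mA mB AB.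
have := mU A (B `\` A) mA (measurableD mB mA) (setDIK _ _).
by rewrite setDUK// => ->; lra.
Qed.

Lemma le_real_measure m A B : real_measure m -> measurable A -> measurable B ->
  A `<=` B -> m A <= m B.
Proof.
move=> rm mA mB AB; rewrite -subr_ge0 -(real_measureD rm)//.
by case: rm => m0 _ _; apply: m0; exact: measurableD.
Qed.

Lemma real_measureU_le m A B : real_measure m -> measurable A ->
  measurable B -> m (A `|` B) <= m A + m B.
Proof.
move=> rm mA mB; have mBA := measurableD mB mA.
have -> : A `|` B = A `|` (B `\` A).
  by apply/seteqP; split=> x /=; have [?|?] := pselect (A x); tauto.
have [_ mU _] := rm; rewrite (mU _ _ mA mBA (setDIK _ _)).
by rewrite lerD2l; apply: le_real_measure => //; exact: subDsetl.
Qed.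

(* Gliding hump: if m (A k) does not tend to 0, one finds disjoint differences
   D_i = A k_i \ A k_i.+1 and indices n_i such that mu n_i is concentrated on
   D_i, up to the sets fixed previously. Taking for E the union of the D_i with i
   even makes mu n_i E oscillate. *)
Lemma real_measure_lim (mu : nat -> set Omega -> R) m :
  (forall n, real_measure (mu n)) ->
  (forall A, measurable A -> mu n A @[n --> \oo] --> m A) ->
  real_measure m.
Proof.
move=> rmu muE.
have m0 A : measurable A -> 0 <= m A.
  move=> mA; rewrite -(cvg_lim _ (muE _ mA))//; apply: limr_ge.
    by apply/cvg_ex; exists (m A); exact: muE.
  by near=> n; have [+ _ _] := rmu n; exact.
have mU A B : measurable A -> measurable B -> A `&` B = set0 ->
    m (A `|` B) = m A + m B.
  move=> mA mB AB0; apply: (cvg_unique _ (muE _ (measurableU _ _ mA mB))).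
    exact: norm_hausdorff.
  rewrite (_ : (fun n => _) = (fun n => mu n A + mu n B)); last first.
    by apply/funext => n; have [_ -> //] := rmu n.
  by apply: cvgD; exact: muE.
split=> // A mA Adecr A0.
have AS i j : (i <= j)%N -> A j `<=` A i.
  by move=> /subnKC <-; elim: (j - i)%N => [|l IH]; rewrite ?addn0// addnS;
    exact: subset_trans (Adecr _) IH.
have mD B C : measurable B -> measurable C -> B `<=` C -> m B <= m C.
  move=> mB mC BC; have := mU _ _ mB (measurableD mC mB) (setDIK _ _).
  by rewrite setDUK// => ->; rewrite lerDl; apply: m0; exact: measurableD.
apply/cvgrPdist_lt => e e0; apply: contrapT => noncvg.
(* [m (A k)] is nonincreasing in [k]: a single value below [e] would keep all later ones below [e],
   against [noncvg]. *)
have Ae k : e <= m (A k).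
  rewrite leNgt; apply/negP => Ake; apply: noncvg; exists k => // j /= kj.
  rewrite sub0r normrN ger0_norm; last exact: m0.
  by apply: le_lt_trans Ake; apply: mD => //; exact: AS.
(* A state holds the current index [k], the set [F] built so far, and a flag telling whether the
   next difference joins [F]. First [n] is taken large, so that [mu n] is [e / 8]-close to [m] on
   both [F] and [A k], where [m (A k)] is at least [e]; then the next index comes from continuity of
   this [mu n] at the empty set. Measurability of [F] is a premise inside the existential so that
   [choice] yields a total function. *)
have : forall s : nat * set Omega * bool, exists p : nat * nat,
    measurable s.1.2 ->
    [/\ (s.1.1 <= p.1)%N, (s.1.1 < p.2)%N, 7 * (e / 8) < mu p.1 (A s.1.1),
        `|m s.1.2 - mu p.1 s.1.2| < e / 8 & mu p.1 (A p.2) < e / 8].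
  move=> [[k F] b] /=; have [mF|nmF] := pselect (measurable F); last first.
    by exists (0, 0)%N.
  have e8 : 0 < e / 8 by lra.
  have /cvgrPdist_lt/(_ _ e8)[n1 _ n1P] := muE _ mF.
  have /cvgrPdist_lt/(_ _ e8)[n2 _ n2P] := muE _ (mA k).
  pose n := maxn k (maxn n1 n2).
  have [_ _ /(_ A mA Adecr A0)/cvgrPdist_lt/(_ _ e8)[k1 _ k1P]] := rmu n.
  exists (n, maxn k.+1 k1) => _ /=; split.
  - exact: leq_maxl.
  - exact: leq_maxl.
  - have /= := n2P n; rewrite !leq_max leqnn !orbT => /(_ isT).
    by have := Ae k; rewrite ltr_distl => ? /andP[]; lra.
  - by have /= := n1P n; rewrite !leq_max leqnn !orbT => /(_ isT).
  - have /= := k1P (maxn k.+1 k1); rewrite leq_maxr => /(_ isT).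
    by rewrite sub0r normrN; exact: le_lt_trans (ler_norm _).
move=> /choice[g gP].
pose nxt (s : nat * set Omega * bool) :=
  ((g s).2, if s.2 then s.1.2 `|` (A s.1.1 `\` A (g s).2) else s.1.2, ~~ s.2).
pose st i := iter i nxt (0%N, set0, true).
pose k i := (st i).1.1; pose F i := (st i).1.2; pose n i := (g (st i)).1.
have bE i : (st i).2 = ~~ odd i by elim: i => //= i ->.
have kS i : k i.+1 = (g (st i)).2 by [].
have FS i : F i.+1 =
    if odd i then F i else F i `|` (A (k i) `\` A (k i.+1)).
  by rewrite /F /= bE; case: (odd i).
have mF i : measurable (F i).
  elim: i => [|i IH]; first exact: measurable0.
  rewrite FS; case: (odd i) => //.
  by apply: measurableU => //; exact: measurableD.
have stP i := gP (st i) (mF i).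
have kn i : (k i <= n i)%N by have [] := stP i.
have kk i : (k i < k i.+1)%N by have [] := stP i.
have ik i : (i <= k i)%N by elim: i => // i /leq_ltn_trans; exact.
have FSsub i : F i `<=` F i.+1.
  by rewrite FS; case: (odd i) => // x ?; left.
have FA i : F i `&` A (k i) = set0.
  apply/seteqP; split => // x [].
  elim: i => // i IH; rewrite FS => + Ax.
  case: (odd i) => [Fx|[Fx|[_ /(_ Ax)//]]];
    by apply: IH => //; apply: AS Ax; exact/ltnW/kk.
(* Whatever is added from stage [i] on lies inside [A (k i)]. *)
have FU i j : F (i + j)%N `<=` F i `|` A (k i).
  elim: j => [|j IH]; first by rewrite addn0 => x ?; left.
  have kij : (k i <= k (i + j))%N.
    elim: (j) => [|l]; rewrite ?addn0// addnS => /leq_trans; apply.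
    exact/ltnW/kk.
  rewrite addnS FS; case: (odd _) => // x [/IH//|[Ax _]].
  by right; apply: AS Ax.
pose E := \bigcup_i F i.
have mE : measurable E by apply: bigcup_measurable => i _; exact: mF.
(* At an even stage [E] contains [F i], of [mu (n i)]-mass above [m (F i) - e / 8], and the disjoint
   difference [A (k i) \ A (k i.+1)], of mass above [7 * (e / 8) - e / 8]. *)
have even_ge i : ~~ odd i -> m (F i) + 5 * (e / 8) < mu (n i) E.
  move=> oi; have [_ _ Ak Fm Ak1] := stP i; have [_ muU _] := rmu (n i).
  have : mu (n i) (F i.+1) <= mu (n i) E.
    by apply: le_real_measure => //; exact: bigcup_sup.
  rewrite FS (negbTE oi) muU//; last 2 first.
  - exact: measurableD.
  - by rewrite setDE setIA FA set0I.
  rewrite real_measureD//; last exact/AS/ltnW/kk.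
  move: Fm; rewrite -/(F i) -/(n i) ltr_norml => /andP[].
  by move: Ak Ak1; rewrite -/(n i) -/(k i) -kS; lra.
(* At an odd stage nothing is added, so [E] is covered by [F i] and [A (k i.+1)]; each of them costs
   at most one error [e / 8]. *)
have odd_le i : odd i -> mu (n i) E < m (F i) + 2 * (e / 8).
  move=> oi; have [_ _ Ak Fm Ak1] := stP i.
  have : mu (n i) E <= mu (n i) (F i `|` A (k i.+1)).
    apply: le_real_measure => //; first exact: measurableU.
    move=> x [j _ Fj]; have <- : F i.+1 = F i by rewrite FS oi.
    apply: (FU _ j); have := Fj; rewrite addnC.
    elim: (i.+1) => [|l IH]; rewrite ?addn0// addnS => /IH; exact: FSsub.
  move=> /le_lt_trans; apply; apply: le_lt_trans (real_measureU_le _ _ _) _ => //.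
  move: Fm; rewrite -/(F i) -/(n i) ltr_norml => /andP[].
  by move: Ak1; rewrite -/(n i) -kS; lra.
(* Both [m (F i)] and [mu (n i) E] converge, the latter because [n i >= i]. Two consecutive stages
   would leave a gap of [3 * (e / 8)] between the even and odd bounds, while four errors of [e / 16]
   amount only to [e / 4]. *)
have [s Fs] : exists s : R, m (F i) @[i --> \oo] --> s.
  apply/cvg_ex; apply: nondecreasing_is_cvgn.
    apply/nondecreasing_seqP => i; exact: mD.
  by exists (m setT) => _ [i _ <-]; apply: mD => //; exact: measurableT.
have nE : mu (n i) E @[i --> \oo] --> m E.
  have /cvgrPdist_lt muEe := muE _ mE.
  apply/cvgrPdist_lt => e' /muEe[N _ NP]; exists N => // i /= Ni.
  by apply: NP => /=; apply: leq_trans Ni _; exact: leq_trans (ik i) (kn i).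
have e16 : 0 < e / 16 by lra.
have /cvgrPdist_lt/(_ _ e16)[N1 _ N1P] := Fs.
have /cvgrPdist_lt/(_ _ e16)[N2 _ N2P] := nE.
(* Doubling makes [N] even, so that [N] and [N.+1] have the parities required by [even_ge] and
   [odd_le]. *)
pose N := (maxn N1 N2).*2.
have N1N : (N1 <= N)%N by rewrite /N -addnn (leq_trans (leq_maxl _ N2))// leq_addr.
have N2N : (N2 <= N)%N by rewrite /N -addnn (leq_trans (leq_maxr N1 _))// leq_addr.
have /even_ge : ~~ odd N by rewrite odd_double.
have /odd_le : odd N.+1 by rewrite /= odd_double.
have /= := N1P _ N1N; have /= := N1P _ (leqW N1N).
have /= := N2P _ N2N; have /= := N2P _ (leqW N2N).
rewrite !ltr_norml => /andP[? ?] /andP[? ?] /andP[? ?] /andP[? ?]; lra.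
Unshelve. all: by end_near. Qed.

Lemma real_measure_fine (P : probability Omega R) :
  real_measure (fun A => fine (P A)).
Proof.
split=> [A mA|A B mA mB AB0|A mA Adecr A0]; first exact: fine_ge0.
  by rewrite measureU// fineD ?fin_num_measure.
rewrite (_ : 0 = fine (P (\bigcap_n A n))); last by rewrite A0 measure0.
apply: fine_cvg; rewrite fineK ?A0 ?measure0// -(measure0 P) -A0.
apply: nonincreasing_cvg_mu => //.
- by rewrite -ge0_fin_numE// fin_num_measure.
- by rewrite A0; exact: measurable0.
- by apply/nonincreasing_seqP => n; exact/subsetPset.
Qed.

Lemma real_measure_preimage m (T : Omega -> Omega) :
  measurable_fun setT T -> real_measure m ->
  real_measure (fun A => m (T @^-1` A)).
Proof.
move=> mT [m0 mU mc].
have mTA A : measurable A -> measurable (T @^-1` A).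
  by move=> mA; rewrite -[X in measurable X]setTI; exact: mT.
split=> [A mA|A B mA mB AB0|A mA Adecr A0]; first exact/m0/mTA.
  rewrite preimage_setU mU//; [exact: mTA|exact: mTA|].
  by rewrite -preimage_setI AB0 preimage_set0.
apply: (mc (fun n => T @^-1` (A n))) => [n|n x|]; [exact: mTA|exact: Adecr|].
by rewrite -preimage_bigcap A0 preimage_set0.
Qed.

Lemma real_measure_restr m B : measurable B -> real_measure m ->
  real_measure (fun A => m (A `&` B)).
Proof.
move=> mB [m0 mU mc]; have mI A := @measurableI _ _ A B.
split=> [A mA|A C mA mC AC0|A mA Adecr A0]; first exact/m0/mI.
  rewrite setIUl mU//; [exact: mI|exact: mI|].
  by rewrite setIACA AC0 set0I.
apply: (mc (fun n => A n `&` B)) => [n|n|]; [exact: mI|exact: setSI|].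
by rewrite bigcapIl ?A0 ?set0I.
Qed.

Lemma real_measureZ c m : 0 <= c -> real_measure m ->
  real_measure (fun A => c * m A).
Proof.
move=> c0 [m0 mU mc]; split=> [A mA|A B mA mB AB0|A mA Adecr A0].
- exact/mulr_ge0/m0.
- by rewrite mU// mulrDr.
- by rewrite -(mulr0 c); apply: cvgMr; exact: mc.
Qed.

Lemma real_measure_sum (mu : nat -> set Omega -> R) n :
  (forall i, real_measure (mu i)) ->
  real_measure (fun A => \sum_(0 <= i < n) mu i A).
Proof.
move=> rmu; split=> [A mA|A B mA mB AB0|A mA Adecr A0].
- by apply: sumr_ge0 => i _; have [+ _ _] := rmu i; exact.
- by rewrite -big_split; apply: eq_bigr => i _; have [_ -> //] := rmu i.
- rewrite [X in _ --> X](_ : _ = \sum_(0 <= i < n) (0 : R)); last by rewrite big1.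
  rewrite (_ : _ \o A = fun k => \sum_(0 <= i < n) mu i (A k))//.
  by apply: cvg_big => [x|i _]; [exact: add_continuous|have [_ _ +] := rmu i; exact].
Qed.

Lemma real_measure_cesaro (mu : nat -> set Omega -> R) n :
  (forall i, real_measure (mu i)) ->
  real_measure (fun A => cesaro_mean (mu^~ A) n).
Proof. by move=> rmu; apply/real_measureZ/real_measure_sum. Qed.

Lemma real_measure_bigsetU m (F : (set Omega)^nat) n : real_measure m ->
  (forall i, measurable (F i)) -> trivIset setT F ->
  m (\big[setU/set0]_(0 <= i < n) F i) = \sum_(0 <= i < n) m (F i).
Proof.
move=> rm mF tF; elim: n => [|n IH].
  by rewrite !big_geq// real_measure0.
rewrite !big_nat_recr//= -IH; have [_ -> //] := rm.
  by apply: bigsetU_measurable.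
by rewrite big_mkord; apply: (@trivIset_bigsetUI _ predT) => //;
  exact: sub_trivIset tF.
Qed.

Lemma real_measure_probability m : real_measure m -> m setT = 1 ->
  exists Q : probability Omega R, forall A, measurable A -> Q A = (m A)%:E.
Proof.
move=> rm m1.
(* [m] is controlled only on measurable sets, whereas nonnegativity of a measure is asked of every
   set; hence the value 0 elsewhere. *)
pose q A := if asbool (measurable A) then (m A)%:E else 0%E : \bar R.
have qE A : measurable A -> q A = (m A)%:E by move=> mA; rewrite /q asboolT.
have q0 : q set0 = 0%E by rewrite qE// real_measure0.
have q_ge0 A : (0 <= q A)%E.
  by rewrite /q; case: asboolP => // mA; rewrite lee_fin; case: rm => + _ _; exact.
have q_sigma : semi_sigma_additive q.
  move=> F mF tF mUF; rewrite qE//.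
  rewrite (_ : (fun n => _) = fun n => (\sum_(0 <= i < n) m (F i))%:E); last first.
    by apply/funext => n; rewrite -sumEFin; apply: eq_bigr => i _; rewrite qE.
  apply: cvg_EFin; first exact: nearW.
  (* A partial sum is the total mass minus the mass of the remainder, and the remainders decrease to
     the empty set. *)
  rewrite (_ : _ \o _ = fun n => m (\bigcup_i F i) -
      m (\bigcup_i F i `\` \big[setU/set0]_(0 <= i < n) F i)); last first.
    apply/funext => n /=; rewrite real_measureD//.
    - by rewrite real_measure_bigsetU//; lra.
    - exact: bigsetU_measurable.
    - by rewrite big_mkord; exact: bigsetU_bigcup.
  rewrite -[X in _ --> X]subr0; apply: cvgB; first exact: cvg_cst.
  have [_ _] := rm; apply => [n|n|].
  - by apply: measurableD => //; exact: bigsetU_measurable.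
  - by apply: setDS; rewrite big_nat_recr//=; exact: subsetUl.
  - apply/seteqP; split=> // x xF; have [[i _ Fx] _] := xF 0%N I.
    have [_] := xF i.+1 I; apply.
    by rewrite big_nat_recr//=; right.
have q1 : q setT = 1%E by rewrite qE// m1.
pose M : {measure set Omega -> \bar R} :=
  HB.pack_for (measure Omega R) q (isMeasure.Build _ _ _ q q0 q_ge0 q_sigma).
pose Q : probability Omega R := HB.pack_for (probability Omega R)
  (Measure.sort M) (Measure.class M) (Measure_isProbability.Build _ _ _ M q1).
by exists Q.
Qed.

End real_measure_theory.

(** * The maximal ergodic inequality and Birkhoff's theorem for bounded functions *)

Section ergodic_theorem.
Context (R : realType) (d : measure_display) (Omega : measurableType d).
Context (T : Omega -> Omega) (mT : measurable_fun [set: Omega] T).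
Implicit Types (f g : Omega -> R) (Q : probability Omega R).

Lemma measurable_iter n : measurable_fun [set: Omega] (iter n T).
Proof.
by elim: n => [|n IH]; [exact: measurable_id|exact: measurableT_comp mT IH].
Qed.

Lemma measurable_gt_cst f (r : R) : measurable_fun setT f ->
  measurable [set w | r < f w].
Proof.
move=> mf; rewrite (_ : mkset _ = setT `&` f @^-1` `]r, +oo[).
  exact: mf.
by apply/seteqP; split=> w /=; rewrite in_itv/= andbT; tauto.
Qed.

Lemma integrable_bounded_by Q f (K : R) : measurable_fun setT f ->
  (forall w, `|f w| <= K) -> Q.-integrable setT (EFin \o f).
Proof.
move=> mf fK; apply: measurable_bounded_integrable => //.
  by rewrite [ltLHS](probability_setT Q) ltry.
by exists K; split; [exact: num_real|move=> x Kx w _; exact: le_trans (ltW Kx)].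
Qed.

Lemma invariant_Rintegral Q f (K : R) : invariant_probability T Q ->
  measurable_fun setT f -> (forall w, `|f w| <= K) ->
  \int[Q]_w f (T w) = \int[Q]_w f w.
Proof.
move=> invQ mf fK; rewrite /Rintegral; congr fine.
have mfT : measurable_fun setT (f \o T) by exact: measurableT_comp.
have ifT : Q.-integrable setT (EFin \o (f \o T)).
  by apply: (@integrable_bounded_by _ _ K) => // w; exact: fK.
have := @integral_pushforward _ _ _ _ R T mT Q setT (EFin \o f).
rewrite preimage_setT => <- //; last exact/measurable_EFinP.
by apply: eq_measure_integral => A mA _; rewrite /= /pushforward invQ.
Qed.

(** The maximum of the Birkhoff sums of lengths 0 to [n], written recursively so that its relation
    to its own composition with [T] is definitional. *)
Fixpoint max_birkhoff_sum g n : Omega -> R :=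
  if n is n'.+1 then fun w => Num.max 0 (g w + max_birkhoff_sum g n' (T w))
  else fun _ => 0.

Definition birkhoff_sum g n w : R := \sum_(0 <= i < n) g (iter i T w).

Lemma birkhoff_sumS g n w :
  birkhoff_sum g n.+1 w = g w + birkhoff_sum g n (T w).
Proof.
rewrite /birkhoff_sum big_nat_recl//=; congr (_ + _).
by apply: eq_bigr => i _; rewrite -iterSr.
Qed.

Lemma measurable_birkhoff_sum g n : measurable_fun setT g ->
  measurable_fun setT (birkhoff_sum g n).
Proof.
move=> mg; apply: measurable_sum => i; apply: measurableT_comp => //.
exact: measurable_iter.
Qed.

Lemma measurable_exists_birkhoff_sum_gt g (r : R) : measurable_fun setT g ->
  measurable [set w | exists n, r < birkhoff_sum g n w].
Proof.
move=> mg; rewrite (_ : mkset _ = \bigcup_n [set w | r < birkhoff_sum g n w]).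
  apply: bigcup_measurable => n _.
  exact/measurable_gt_cst/measurable_birkhoff_sum.
by apply/seteqP; split=> w [n]; exists n.
Qed.

Lemma max_birkhoff_sum_ge0 g n w : 0 <= max_birkhoff_sum g n w.
Proof. by case: n => //= n; rewrite le_max lexx. Qed.

Lemma max_birkhoff_sum_le g n w :
  max_birkhoff_sum g n w <= max_birkhoff_sum g n.+1 w.
Proof.
elim: n w => [|n IH] w; first exact: max_birkhoff_sum_ge0.
by rewrite /= le_max2// lerD2l; exact: IH.
Qed.

Lemma birkhoff_sum_le_max g n w : birkhoff_sum g n w <= max_birkhoff_sum g n w.
Proof.
elim: n w => [|n IH] w; first by rewrite /birkhoff_sum big_geq.
by rewrite birkhoff_sumS /= le_max lerD2l IH orbT.
Qed.

Lemma measurable_max_birkhoff_sum g n : measurable_fun setT g ->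
  measurable_fun setT (max_birkhoff_sum g n).
Proof.
move=> mg; elim: n => [|n IH]; first exact: measurable_cst.
apply: measurable_maxr => //; apply: measurable_funD => //.
exact: measurableT_comp.
Qed.

Lemma max_birkhoff_sum_bounded g (K : R) n w : (forall x, `|g x| <= K) ->
  `|max_birkhoff_sum g n w| <= n%:R * K.
Proof.
move=> gK; rewrite ger0_norm ?max_birkhoff_sum_ge0//.
elim: n w => [|n IH] w; first by rewrite mul0r.
have K0 : 0 <= K by exact: le_trans (gK w).
rewrite /= ge_max mulr_ge0//= -natr1 mulrDl mul1r addrC lerD ?IH//.
by rewrite (le_trans (ler_norm _)).
Qed.

(* Pointwise, g 1_E >= M_(n+1) - M_n o T for E = {M_(n+1) > 0}, and the integral
   of the right-hand side is nonnegative by invariance and monotonicity of M. *)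
Lemma maximal_ergodic_inequality Q g (K : R) n : invariant_probability T Q ->
  measurable_fun setT g -> (forall w, `|g w| <= K) ->
  0 <= \int[Q]_w (g w * \1_[set x | 0 < max_birkhoff_sum g n.+1 x] w).
Proof.
move=> invQ mg gK; set E := mkset _.
pose M := max_birkhoff_sum g.
have mM k : measurable_fun setT (M k) by exact: measurable_max_birkhoff_sum.
have MK k w : `|M k w| <= k%:R * K by exact: max_birkhoff_sum_bounded.
have iM k : Q.-integrable setT (EFin \o M k) by exact: integrable_bounded_by (MK k).
have iMT k : Q.-integrable setT (EFin \o (M k \o T)).
  apply: (@integrable_bounded_by _ _ (k%:R * K)); first exact: measurableT_comp.
  by move=> w; exact: MK.
have mE : measurable E by exact/measurable_gt_cst/mM.
apply: (@le_trans _ _ (\int[Q]_w (M n.+1 w - M n (T w)))).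
  rewrite RintegralB//; last exact: iMT.
  rewrite (invariant_Rintegral invQ (mM n) (MK n)) subr_ge0.
  by apply: le_Rintegral => // w _; exact: max_birkhoff_sum_le.
apply: le_Rintegral => //.
- by apply: (@integrableB _ _ _ _ _ _ (EFin \o M n.+1) (EFin \o (M n \o T))).
- apply: (@integrable_bounded_by _ _ K).
    by apply: measurable_funM => //; exact: measurable_indic.
  move=> w; rewrite normrM; apply: le_trans (gK w).
  by rewrite ler_piMr// indicE; case: (w \in E); rewrite ?normr1 ?normr0.
- move=> w _; have := max_birkhoff_sum_ge0 g n (T w).
  rewrite indicE /M /=; case: (boolP (w \in E)) => [/set_mem|/negP wE] /=.
    by rewrite /E /=; case: (ltP 0 (g w + _)); lra.
  suff : ~ 0 < max_birkhoff_sum g n.+1 w by rewrite /=; case: ltP; lra.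
  by move=> ?; apply: wE; exact/mem_set.
Qed.

(** Since [g >= - K], one has [g >= g 1_E + K 1_E - K] for [E = E n]. The first term has nonnegative
    integral by the maximal inequality, and the rest integrates to [K * Q (E n) - K], which tends to
    0 because the increasing sets [E n] exhaust a set of full measure. *)
Lemma Rintegral_ge0_of_birkhoff_sum_gt0 Q g (K : R) :
  invariant_probability T Q -> measurable_fun setT g ->
  (forall w, `|g w| <= K) ->
  Q [set w | exists n, 0 < birkhoff_sum g n w] = 1%E -> 0 <= \int[Q]_w g w.
Proof.
move=> invQ mg gK Q1.
pose E n := [set w | 0 < max_birkhoff_sum g n.+1 w].
have mE n : measurable (E n).
  exact/measurable_gt_cst/measurable_max_birkhoff_sum.
have ig : Q.-integrable setT (EFin \o g) by exact: integrable_bounded_by gK.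
have i1 (c : R) n : Q.-integrable setT (EFin \o (fun w => c * \1_(E n) w)).
  apply: (@integrable_bounded_by _ _ `|c|).
    by apply: measurable_funM => //; exact: measurable_indic.
  move=> w; rewrite normrM ler_piMr// indicE.
  by case: (w \in E n); rewrite ?normr1 ?normr0.
have igE n : Q.-integrable setT (EFin \o (fun w => g w * \1_(E n) w)).
  apply: (@integrable_bounded_by _ _ K).
    by apply: measurable_funM => //; exact: measurable_indic.
  move=> w; rewrite normrM; apply: le_trans (gK w).
  by rewrite ler_piMr// indicE; case: (w \in E n); rewrite ?normr1 ?normr0.
have iK : Q.-integrable setT (EFin \o (fun=> - K)).
  by apply: (@integrable_bounded_by _ _ `|K|) => // w; rewrite normrN.
have iD f1 f2 : Q.-integrable setT (EFin \o f1) ->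
    Q.-integrable setT (EFin \o f2) ->
    Q.-integrable setT (EFin \o (fun w => f1 w + f2 w)).
  by move=> i1' i2; exact: (@integrableD _ _ _ _ _ _ _ _ i1' i2).
have ge n : K * fine (Q (E n)) - K <= \int[Q]_w g w.
  have := maximal_ergodic_inequality n invQ mg gK.
  rewrite -/(E n) => max_ge0.
  apply: (@le_trans _ _
      (\int[Q]_w ((g w * \1_(E n) w) + (K * \1_(E n) w + - K)))).
    rewrite RintegralD//; last by apply: iD.
    rewrite RintegralD//.
    rewrite Rintegral_cst// [fine (Q setT)](_ : _ = 1); last first.
      by rewrite probability_setT.
    have -> : \int[Q]_w (K * \1_(E n) w) = K * fine (Q (E n)).
      rewrite RintegralZl//; last first.
        by have := i1 1 n; under eq_fun do rewrite mul1r.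
      by rewrite /Rintegral integral_indic// setIT.
    by rewrite mulr1 lerDr.
  apply: le_Rintegral => //; first exact: (iD _ _ (igE n) (iD _ _ (i1 K n) iK)).
  move=> w _; rewrite indicE.
  by have := gK w; rewrite ler_norml => /andP[]; case: (w \in E n) => /=; lra.
have QE : fine (Q (E n)) @[n --> \oo] --> (1 : R).
  apply: fine_cvg; rewrite [X in _ --> X](_ : _ = Q (\bigcup_n E n)).
    apply: nondecreasing_cvg_mu => //; first exact: bigcup_measurable.
    apply/nondecreasing_seqP => n; apply/subsetPset => w /lt_le_trans; apply.
    exact: max_birkhoff_sum_le.
  apply/esym/eqP; rewrite eq_le probability_le1//=; last exact: bigcup_measurable.
  rewrite -Q1; apply: le_measure; rewrite ?inE//.
  - exact: measurable_exists_birkhoff_sum_gt.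
  - exact: bigcup_measurable.
  move=> w [n /lt_le_trans nw]; exists n => //; apply: nw.
  exact: le_trans (birkhoff_sum_le_max _ _ _) (max_birkhoff_sum_le _ _ _).
have : K * fine (Q (E n)) - K @[n --> \oo] --> K * 1 - K.
  by apply: cvgB; [apply: cvgMr|exact: cvg_cst].
rewrite mulr1 subrr => cvg0.
rewrite -(cvg_lim _ cvg0)//; apply: limr_le; first by apply/cvg_ex; exists 0.
exact: nearW.
Qed.


Definition birkhoff_unbounded g : set Omega :=
  [set w | forall k : nat, exists n, k%:R < birkhoff_sum g n w].

(** The sum of length [n.+1] at [w] and the sum of length [n] at [T w] differ by [g w], which is
    bounded, so unboundedness above passes both ways. *)
Lemma birkhoff_unbounded_invariant g (K : R) : measurable_fun setT g ->
  (forall w, `|g w| <= K) -> invariant_sets T (birkhoff_unbounded g).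
Proof.
move=> mg gK; split.
  rewrite (_ : birkhoff_unbounded g =
      \bigcap_k [set w | exists n, k%:R < birkhoff_sum g n w]); last first.
    by apply/seteqP; split=> w wU k; [move=> _; exact: wU|exact: wU k I].
  apply: bigcap_measurable => // k _.
  exact: measurable_exists_birkhoff_sum_gt.
pose b := Num.bound `|K|; have := ler_norm K; have := archi_boundP (normr_ge0 K).
rewrite -/b => Kb KK.
have gb w : - b%:R <= g w <= b%:R.
  by have := gK w; rewrite ler_norml => /andP[]; lra.
(* The level [k + b] leaves room for the term [g w]. In the second inclusion length 0 is excluded,
   the empty sum being 0. *)
apply/seteqP; split=> w /= wU k; have /andP[gb1 gb2] := gb w;
    have [n] := wU (k + b)%N; rewrite natrD => kn.
- by exists n.+1; rewrite birkhoff_sumS; lra.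
- case: n kn => [|n]; first by rewrite /birkhoff_sum big_geq// -natrD ltNge ler0n.
  by rewrite birkhoff_sumS => kn; exists n; lra.
Qed.

(** By ergodicity the only alternative is full measure; then almost every point has a positive
    Birkhoff sum, which would force a nonnegative integral. *)
Lemma ergodic_birkhoff_unbounded0 Q g (K : R) : ergodic_probabilities T Q ->
  measurable_fun setT g -> (forall w, `|g w| <= K) -> \int[Q]_w g w < 0 ->
  Q (birkhoff_unbounded g) = 0%E.
Proof.
move=> [invQ ergQ] mg gK; have invU := birkhoff_unbounded_invariant mg gK.
have [//|Q1] := ergQ _ invU.
rewrite ltNge => /negP; case.
apply: (Rintegral_ge0_of_birkhoff_sum_gt0 invQ mg gK).
have mE := measurable_exists_birkhoff_sum_gt 0 mg.
apply/eqP; rewrite eq_le probability_le1//= -Q1.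
apply: le_measure; rewrite ?inE//; first by case: invU.
by move=> w /(_ 0%N)[n]; exists n.
Qed.

Lemma cesaro_cvg_of_bounded (u : R^nat) (c : R) :
  (forall k : nat, exists C : R, forall n,
    `|\sum_(0 <= i < n) u i - n%:R * c| <= n%:R * k.+1%:R^-1 + C) ->
  cesaro_mean u @ \oo --> c.
Proof.
move=> uC; apply/cvgrPdist_lt => e e0.
have [k ke] : exists k : nat, k.+1%:R^-1 < e / 2.
  have e2 : 0 < e / 2 by lra.
  have [k _ kP] := near_infty_natSinv_lt (PosNum e2).
  by exists k; have /= := kP k; apply.
have [C CP] := uC k.
(* Beyond this rank [C < n * (e / 2)]; the successor keeps [n] positive, so that [n%:R^-1] is a true
   inverse. *)
exists (Num.bound `|2 * C / e|).+1 => // n /= Cn.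
have n0 : 0 < n%:R :> R by rewrite ltr0n; case: n Cn.
have nC : 2 * C / e < n%:R.
  apply: le_lt_trans (ler_norm _) _; apply: lt_le_trans (archi_boundP _) _ => //.
  by rewrite ler_nat ltnW.
rewrite distrC /cesaro_mean.
rewrite -(ltr_pM2l n0) -[X in X * `|_|](gtr0_norm n0) -normrM mulrBr mulrA.
rewrite divff ?gt_eqF// mul1r; apply: le_lt_trans (CP n) _.
rewrite -subr_gt0 in ke; have := mulr_gt0 n0 ke.
move: nC; rewrite ltr_pdivrMr// mulrBr; set x := n%:R * _^-1; lra.
Qed.

Lemma invariant_setsC A : invariant_sets T A -> invariant_sets T (~` A).
Proof.
by move=> [mA TA]; split; [exact: measurableC|rewrite -preimage_setC TA].
Qed.

Lemma invariant_setsI A B : invariant_sets T A -> invariant_sets T B ->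
  invariant_sets T (A `&` B).
Proof.
by move=> [mA TA] [mB TB]; split; [exact: measurableI|rewrite preimage_setI TA TB].
Qed.

Lemma invariant_setsU A B : invariant_sets T A -> invariant_sets T B ->
  invariant_sets T (A `|` B).
Proof.
by move=> [mA TA] [mB TB]; split; [exact: measurableU|rewrite preimage_setU TA TB].
Qed.

Lemma invariant_sets_bigcup (A : (set Omega)^nat) :
  (forall n, invariant_sets T (A n)) -> invariant_sets T (\bigcup_n A n).
Proof.
move=> iA; split; first by apply: bigcup_measurable => n _; case: (iA n).
by rewrite preimage_bigcup; apply: eq_bigcup => // n; case: (iA n).
Qed.

(* The set where the Birkhoff sums of f - c - e are unbounded above is strictly
   invariant, and it contains the points where limsup of the averages exceeds
   c + e; the same holds for c - e - f below. *)
Lemma birkhoff_ergodic Q f (K : R) : ergodic_probabilities T Q ->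
  measurable_fun setT f -> (forall w, `|f w| <= K) ->
  exists2 N, invariant_sets T N /\ Q N = 0%E &
    forall w, ~ N w ->
      cesaro_mean (fun i => f (iter i T w)) @ \oo --> \int[Q]_x f x.
Proof.
move=> ergQ mf fK; set c := \int[Q]_x f x.
have if_ : Q.-integrable setT (EFin \o f) by exact: integrable_bounded_by fK.
have icst (r : R) : Q.-integrable setT (EFin \o (fun=> r)).
  by apply: (@integrable_bounded_by _ _ `|r|).
have intcst (r : R) : \int[Q]_x r = r.
  by rewrite Rintegral_cst// [X in fine X](probability_setT Q) mulr1.
pose e (k : nat) : R := k.+1%:R^-1; have e0 k : 0 < e k by rewrite invr_gt0.
pose g k w := f w + - (c + e k); pose h k w := c - e k - f w.
have mg k : measurable_fun setT (g k) by exact: measurable_funD.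
have mh k : measurable_fun setT (h k) by exact: measurable_funB.
have gK k w : `|g k w| <= K + `|c + e k|.
  by rewrite (le_trans (ler_normB _ _))// lerD2r.
have hK k w : `|h k w| <= `|c - e k| + K.
  by rewrite (le_trans (ler_normB _ _))// lerD2l.
have g_lt0 k : \int[Q]_w g k w < 0.
  by rewrite RintegralD// intcst; have := e0 k; rewrite -/c; lra.
have h_lt0 k : \int[Q]_w h k w < 0.
  by rewrite RintegralB// intcst; have := e0 k; rewrite -/c; lra.
pose N k := birkhoff_unbounded (g k) `|` birkhoff_unbounded (h k).
have iN k : invariant_sets T (N k).
  exact: invariant_setsU (birkhoff_unbounded_invariant (mg k) (gK k))
                         (birkhoff_unbounded_invariant (mh k) (hK k)).
exists (\bigcup_k N k).
  split; first exact: invariant_sets_bigcup.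
  have NN k : Q.-negligible (N k).
    apply: negligibleU; apply/negligibleP.
    - by case: (birkhoff_unbounded_invariant (mg k) (gK k)).
    - exact: ergodic_birkhoff_unbounded0 (g_lt0 k).
    - by case: (birkhoff_unbounded_invariant (mh k) (hK k)).
    - exact: ergodic_birkhoff_unbounded0 (h_lt0 k).
  apply/negligibleP; last exact: negligible_bigcup.
  by apply: bigcup_measurable => k _; case: (iN k).
move=> w Nw; apply: cesaro_cvg_of_bounded => k.
have := contra_not (fun Nk => ex_intro2 _ _ k I Nk) Nw.
move=> /not_orP[/existsNP[a /forallNP ga] /existsNP[b /forallNP hb]].
have sumE n (r : R) : \sum_(0 <= i < n) r = n%:R * r.
  by rewrite big_const_nat subn0 iter_addr_0 mulr_natl.
(* The sums of [g k] stay below [a] and those of [h k] below [b]; these are the upper and lower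
   bounds for the centered sums of [f]. *)
exists (a%:R + b%:R) => n; rewrite ler_norml.
have := ga n; have := hb n; rewrite /birkhoff_sum /g /h.
rewrite !sumrB !sumE mulrDr => /negP + /negP; rewrite -!leNgt.
have : 0 <= a%:R :> R by []; have : 0 <= b%:R :> R by [].
rewrite -/(e k) => *; apply/andP; split; lra.
Qed.

End ergodic_theorem.

(** * Cesaro means of constant and of shifted sequences *)

Section cesaro.
Context {R : realType}.
Implicit Types u : R^nat.

Lemma cesaro_cst (c : R) : cesaro_mean (fun=> c) @ \oo --> c.
Proof.
apply: cesaro_cvg_of_bounded => k; exists 0 => n.
by rewrite big_const_nat subn0 iter_addr_0 mulr_natl subrr normr0 addr0 mulr_ge0.
Qed.

(** The shift changes the [n]-th sum only by [u n - u 0], of absolute value at most 1, and division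
    by [n] removes it. *)
Lemma cesaro_shift u (l : R) : (forall i, 0 <= u i <= 1) ->
  cesaro_mean u @ \oo --> l -> cesaro_mean (fun i => u i.+1) @ \oo --> l.
Proof.
move=> u01 ul.
rewrite (_ : cesaro_mean _ =
    fun n => cesaro_mean u n + n%:R^-1 * (u n - u 0%N)); last first.
  apply/funext => n; rewrite /cesaro_mean -mulrDr; congr (_ * _).
  rewrite (addrC (u n)) addrA -[RHS]addrAC -big_nat_recr//= big_nat_recl//=.
  by lra.
rewrite -[l]addr0; apply: cvgD => //; apply/cvgrPdist_lt => e e0.
exists (Num.bound e^-1).+1 => // n /= en.
have n0 : 0 < n%:R :> R by rewrite ltr0n; case: n en.
rewrite sub0r normrN normrM gtr0_norm ?invr_gt0// ltr_pdivrMl//.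
apply: (@le_lt_trans _ _ 1).
  rewrite ler_norml; have /andP[] := u01 n; have /andP[] := u01 0%N; lra.
rewrite -ltr_pdivrMr// mul1r.
apply: lt_le_trans (archi_boundP _) _; first by rewrite invr_ge0 ltW.
by rewrite ler_nat ltnW.
Qed.

End cesaro.

(** * Irreducible blocks, the stationary mean, and the ergodic probabilities they carry *)

Section irreducible_invariant_sets.
Context (R : realType) (d : measure_display) (Omega : measurableType d).
Context (P : probability Omega R) (T : Omega -> Omega).
Context (mT : measurable_fun [set: Omega] T).
Implicit Types A B : set Omega.

Definition irreducible_invariant A : Prop :=
  [/\ (0 < P A)%E, invariant_sets T A &
      ~ exists B, [/\ invariant_sets T B, B `<=` A & (0 < P B < P A)%E]].

Lemma invariant_sets_iter A i : invariant_sets T A -> iter i T @^-1` A = A.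
Proof.
move=> [mA TA]; elim: i => //= i IH.
by rewrite -[RHS]IH -[in RHS]TA.
Qed.

Lemma partitionU (al be : set (set Omega)) A B : A `&` B = set0 ->
  classical_sets.partition al id A -> classical_sets.partition be id B ->
  classical_sets.partition (al `|` be) id (A `|` B).
Proof.
move=> AB0 [cA tA nA] [cB tB nB]; split.
- by rewrite /cover bigcup_setU; congr (_ `|` _).
- have sA X x : al X -> X x -> A x by move=> alX Xx; rewrite -cA; exists X.
  have sB X x : be X -> X x -> B x by move=> beX Xx; rewrite -cB; exists X.
  have no x : A x -> B x -> False.
    by move=> Ax Bx; have : (A `&` B) x by []; rewrite AB0.
  move=> X Y [aX|bX] [aY|bY] [x [Xx Yx]].
  + by apply: tA => //; exists x.
  + by case: (no x); [exact: sA Xx|exact: sB Yx].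
  + by case: (no x); [exact: sA Yx|exact: sB Xx].
  + by apply: tB => //; exists x.
- by move=> X [/nA|/nB].
Qed.

(** Induction on the number of values of [P] on invariant subsets of [A]; a general [A] in place of
    the whole space lets both parts of a splitting be treated. *)
Lemma finite_values_irreducible_partition A :
  finite_set (P @` [set B | invariant_sets T B /\ B `<=` A]) ->
  invariant_sets T A -> (0 < P A)%E ->
  exists al : set (set Omega), [/\ classical_sets.partition al id A, finite_set al &
    forall B, al B -> irreducible_invariant B].
Proof.
pose val A := P @` [set B | invariant_sets T B /\ B `<=` A].
rewrite -/(val A).
have [n] := ubnP (size (finmap.enum_fset (fset_set (val A)))).
elim: n A => // n IH A valn fA iA PA0.
have [irr|/contrapT[B [iB BA /andP[PB0 PBA]]]] := pselect (~ exists B,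
    [/\ invariant_sets T B, B `<=` A & (0 < P B < P A)%E]).
  exists [set A]; split => //; last by move=> _ ->; split.
  split; first by rewrite /cover bigcup_set1.
  - by move=> X Y -> ->.
  - move=> _ ->; apply/set0P/negP => /eqP A0.
    by move: PA0; rewrite A0 measure0 ltxx.
have mA : measurable A by case: iA.
have mB : measurable B by case: iB.
have iD : invariant_sets T (A `\` B).
  by rewrite setDE; apply: invariant_setsI => //; exact: invariant_setsC.
have PD : P (A `\` B) = (P A - P B)%E.
  by rewrite measureD ?setIidr// -ge0_fin_numE// fin_num_measure.
have PDA : (P (A `\` B) < P A)%E.
  by rewrite PD lteBlDr ?fin_num_measure// lteDl// fin_num_measure.
have sub C : C `<=` A -> val C `<=` val A.
  by move=> CA _ [X [iX XC] <-]; exists X => //; split => //; exact: subset_trans CA.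
have small C : invariant_sets T C -> C `<=` A -> (0 < P C)%E -> (P C < P A)%E ->
    exists al : set (set Omega), [/\ classical_sets.partition al id C,
      finite_set al & forall B, al B -> irreducible_invariant B].
  move=> iC CA PC0 PCA; have fC := sub_finite_set (sub _ CA) fA.
  apply: IH => //; rewrite -ltnS; apply: leq_trans valn; rewrite ltnS.
  (* The value [P A] is lost in passing to [C], whose invariant subsets have mass at most
     [P C < P A]; put back in front, it gives a duplicate-free list of values of [val A]. *)
  apply: (@uniq_leq_size _ (P A :: finmap.enum_fset (fset_set (val C)))).
    rewrite /= finmap.fset_uniq andbT; apply/negP.
    rewrite in_fset_set// inE => -[X [[mX _] XC] PX].
    have : (P X <= P C)%E by apply: le_measure; rewrite ?inE//; case: iC.
    by rewrite PX leNgt PCA.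
  move=> x; rewrite inE !in_fset_set// !inE => /predU1P[->|/set_mem].
    by exists A; [split|].
  exact: (sub C CA).
have [al [pal fal ial]] := small B iB BA PB0 PBA.
have [|be [pbe fbe ibe]] := small (A `\` B) iD (@subDsetl _ _ _) _ PDA.
  by rewrite PD sube_gt0.
exists (al `|` be); split; last by move=> X [/ial|/ibe].
  by rewrite -(setDUK BA); apply: partitionU => //; exact: setDIK.
by rewrite finite_setU.
Qed.

Context (limP : forall A, measurable A ->
  cvgn (cesaro_mean (fun i => fine (P (iter i T @^-1` A))))).

Definition stationary_mean A : R :=
  limn (cesaro_mean (fun i => fine (P (iter i T @^-1` A)))).

Lemma measurable_preimage_iter i A : measurable A ->
  measurable (iter i T @^-1` A).
Proof.
by move=> mA; rewrite -[X in measurable X]setTI; exact: (measurable_iter mT).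
Qed.

Lemma real_measure_stationary_mean : real_measure stationary_mean.
Proof.
apply: (@real_measure_lim _ _ _
  (fun n A => cesaro_mean (fun i => fine (P (iter i T @^-1` A))) n)).
- move=> n; apply: (@real_measure_cesaro _ _ _
    (fun i A => fine (P (iter i T @^-1` A)))) => i.
  exact: (real_measure_preimage (measurable_iter mT i) (real_measure_fine P)).
- by move=> A /limP.
Qed.

(** Replacing [A] by its preimage shifts the averaged sequence by one index. *)
Lemma stationary_mean_preimage A : measurable A ->
  stationary_mean (T @^-1` A) = stationary_mean A.
Proof.
move=> mA; apply/cvg_lim => //.
apply: (@cesaro_shift _ (fun i => fine (P (iter i T @^-1` A)))); last exact: limP.
move=> i; have mi := measurable_preimage_iter i mA.
rewrite fine_ge0//= -lee_fin fineK ?fin_num_measure//.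
exact: probability_le1.
Qed.

Lemma stationary_mean_invariant A : invariant_sets T A ->
  stationary_mean A = fine (P A).
Proof.
move=> iA; rewrite /stationary_mean.
have -> : (fun i => fine (P (iter i T @^-1` A))) = fun=> fine (P A).
  by apply/funext => i; rewrite invariant_sets_iter.
by apply/cvg_lim => //; exact: cesaro_cst.
Qed.

(** [Q] is the stationary mean conditioned on [A]. On an invariant [B] it equals [P (B & A) / P A],
    with [&] for intersection, and irreducibility leaves only 0 and 1. The same formula carries
    invariant [Q]-null sets back to [P], as needed for the exceptional set in Birkhoff's theorem. *)
Lemma ergodic_of_irreducible A : irreducible_invariant A ->
  exists Q : probability Omega R, ergodic_probabilities T Q /\
    forall B, invariant_sets T B -> Q B = 0%E -> P (B `&` A) = 0%E.
Proof.
move=> [PA0 iA irr]; have [mA TA] := iA.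
have p0 : 0 < fine (P A).
  by rewrite fine_gt0// PA0/= -ge0_fin_numE// fin_num_measure.
have rm : real_measure
    (fun B => (fine (P A))^-1 * stationary_mean (B `&` A)).
  apply: real_measureZ; first by rewrite invr_ge0 ltW.
  exact: real_measure_restr real_measure_stationary_mean.
have [|Q QE] := real_measure_probability rm.
  by rewrite setTI stationary_mean_invariant// mulVf// gt_eqF.
exists Q; split; first split.
- move=> B mB; have mTB := measurable_preimage_iter 1 mB.
  have TBA : T @^-1` B `&` A = T @^-1` (B `&` A) by rewrite preimage_setI TA.
  by rewrite !QE// TBA stationary_mean_preimage//; exact: measurableI.
- move=> B iB; have [mB _] := iB; have iBA := invariant_setsI iB iA.
  have mBA : measurable (B `&` A) by case: iBA.
  rewrite QE// stationary_mean_invariant//.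
  have PBA : (P (B `&` A) <= P A)%E by apply: le_measure; rewrite ?inE.
  have [->|PBA0] := eqVneq (P (B `&` A)) 0%E; first by left; rewrite mulr0.
  right; suff -> : P (B `&` A) = P A by rewrite mulVf// gt_eqF.
  apply/eqP; rewrite eq_le PBA/= leNgt; apply/negP => lt; apply: irr.
  exists (B `&` A); split=> //.
  by rewrite lt lt0e PBA0 measure_ge0.
- move=> B iB; have [mB _] := iB; have iBA := invariant_setsI iB iA.
  rewrite QE// stationary_mean_invariant// => -[/eqP].
  rewrite mulf_eq0 invr_eq0 gt_eqF//= => /eqP PBA.
  by rewrite -(fineK (fin_num_measure P _ (proj1 iBA))) PBA.
Qed.

Lemma irreducible_partition_birkhoff :
  finite_irreducible_invariant_partition_assumption P T ->
  exists (n : nat) (Q : 'I_n -> probability Omega R) (A : 'I_n -> set Omega),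
    [/\ forall j, ergodic_probabilities T (Q j),
        measurable_partition A,
        forall j, (0 < P (A j))%E &
        forall f : Omega -> R, measurable_fun [set: Omega] f ->
          [bounded f w | w in [set: Omega]] ->
          {ae P, forall w,
            cesaro_mean (fun i => f (iter i T w)) @ \oo -->
            \sum_(j < n) (\int[Q j]_x f x) * \1_(A j) w}].
Proof.
move=> [al [[cal tal nal] fal ial]].
pose s : seq (set Omega) := finmap.enum_fset (fset_set al).
pose A (j : 'I_(size s)) := nth set0 s j.
have sal X : X \in s <-> al X by rewrite in_fset_set// inE.
have alA j : al (A j) by apply/sal; exact: mem_nth.
have irrA j : irreducible_invariant (A j) by exact: ial.
have tA i j w : A i w -> A j w -> i = j.
  move=> Aiw Ajw; apply/val_inj/eqP.
  rewrite -(nth_uniq set0 (ltn_ord i) (ltn_ord j) (finmap.fset_uniq _)).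
  apply/eqP; apply: tal; [exact: alA|exact: alA|by exists w].
have cA w : exists j, A j w.
  have : setT w by []; rewrite -cal => -[X alX Xw].
  have Xs : (index X s < size s)%N by rewrite index_mem; exact/sal.
  exists (Ordinal Xs); rewrite /A /= nth_index//; exact/sal.
have /choice[Q QP] := fun j => ergodic_of_irreducible (irrA j).
exists (size s), Q, A; split.
- by move=> j; have [] := QP j.
- split; last by move=> j; have [_ []] := irrA j.
  split; last by move=> j _; exact: nal.
  + by rewrite -subTset => w _; have [j] := cA w; exists j.
  + by move=> i j _ _ [w [Ai Aj]]; exact: tA Ai Aj.
- by move=> j; have [] := irrA j.
move=> f mf [M [_ fM]].
have fK w : `|f w| <= M + 1 by apply: fM; rewrite ?ltrDl.
have /choice[N NP] : forall j, exists N, [/\ invariant_sets T N, Q j N = 0%E &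
    forall w, ~ N w ->
      cesaro_mean (fun i => f (iter i T w)) @ \oo --> \int[Q j]_x f x].
  move=> j; have [N [iN QN] cN] := birkhoff_ergodic mT (QP j).1 mf fK.
  by exists N; split.
(* [N j] matters only inside its own block, and there it is [P]-null. *)
have aeN : {ae P, forall w, forall j, A j w -> ~ N j w}.
  apply: filter_forall => j; have [iN QN _] := NP j; have [_ iA _] := irrA j.
  exists (N j `&` A j); split.
  - by apply: measurableI; [case: iN|case: iA].
  - exact: (QP j).2.
  - by move=> w /= /not_implyP[Aw /contrapT Nw].
apply: filterS aeN => w Nw; have [j Aj] := cA w.
have [_ _ cN] := NP j; have := cN w (Nw j Aj); congr (_ --> _).
rewrite (bigD1 j)//= indicE mem_set// mulr1 big1 ?addr0// => i ij.
rewrite indicE memNset ?mulr0// => Ai; move: ij.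
by rewrite (tA _ _ _ Ai Aj) eqxx.
Qed.

End irreducible_invariant_sets.

(** * From almost sure averages to correlations, and from these to finitely many invariant values *)

Lemma Rintegral_sum_indic (R : realType) (d : measure_display)
    (Omega : measurableType d) (P : probability Omega R) (I : Type) (s : seq I)
    (c : I -> R) (E : I -> set Omega) (B : set Omega) :
  measurable B -> (forall i, measurable (E i)) ->
  \int[P]_(w in B) (\sum_(i <- s) c i * \1_(E i) w) =
  \sum_(i <- s) c i * fine (P (E i `&` B)).
Proof.
move=> mB mE.
have iE i : P.-integrable setT (EFin \o \1_(E i)).
  apply: (@integrable_bounded_by _ _ _ _ _ 1); first exact: measurable_indic.
  by move=> w; rewrite indicE; case: (w \in E i); rewrite ?normr1 ?normr0.
have icE i : P.-integrable setT (EFin \o (fun w => c i * \1_(E i) w)).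
  exact: (integrableZl _ (c i) (iE i)).
have isum r : P.-integrable setT
    (EFin \o (fun w => \sum_(i <- r) c i * \1_(E i) w)).
  rewrite (_ : _ \o _ = fun w => (\sum_(i <- r) (c i * \1_(E i) w)%:E)%E).
    by apply: integrable_sum => // i _; exact: icE.
  by apply/funext => w /=; rewrite sumEFin.
have iB f : P.-integrable setT (EFin \o f) -> P.-integrable B (EFin \o f).
  by apply: integrableS.
elim: s => [|i s IH].
  by under eq_Rintegral do rewrite big_nil; rewrite big_nil Rintegral_cst// mul0r.
under eq_Rintegral do rewrite big_cons.
rewrite RintegralD//; [|exact: iB|exact: iB].
rewrite IH big_cons RintegralZl//; last exact: iB.
by rewrite /Rintegral integral_indic.
Qed.

Section equivalences.
Context (R : realType) (d : measure_display) (Omega : measurableType d).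
Context (P : probability Omega R) (T : Omega -> Omega).
Context (mT : measurable_fun [set: Omega] T).
Context (n : nat) (Q : 'I_n -> probability Omega R) (A : 'I_n -> set Omega).
Context (mA : forall j, measurable (A j)).

(** Dominated convergence on [B] with the constant 1 as bound; [Rintegral_sum_indic] evaluates both
    the averages and their limit. *)
Lemma cesaro_correlation_of_birkhoff (B C : set Omega) :
  measurable B -> measurable C ->
  {ae P, forall w, cesaro_mean (fun i => \1_C (iter i T w) : R) @ \oo -->
    \sum_(j < n) (\int[Q j]_x \1_C x) * \1_(A j) w} ->
  cesaro_mean (fun i => fine (P (B `&` iter i T @^-1` C))) @ \oo -->
    \sum_(j < n) fine (Q j C) * fine (P (A j `&` B)).
Proof.
move=> mB mC aeC.
have mTC i : measurable (iter i T @^-1` C) by exact: measurable_preimage_iter.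
pose F N w : R := \sum_(0 <= i < N) N%:R^-1 * \1_(iter i T @^-1` C) w.
pose G w : R := \sum_(j < n) fine (Q j C) * \1_(A j) w.
have mF N : measurable_fun B (F N).
  by apply: measurable_sum => i; apply: measurable_funM.
have mG : measurable_fun B G.
  by apply: measurable_sum => i; apply: measurable_funM.
have F1 N w : `|F N w| <= 1.
  rewrite ger0_norm /F -mulr_sumr; last first.
    by rewrite mulr_ge0//; apply: sumr_ge0 => i _; rewrite indicE.
  (* At [N = 0] the average is 0 by the convention on inverses. *)
  have [->|N0] := posnP N; first by rewrite invr0 mul0r.
  rewrite ler_pdivrMl ?ltr0n// mulr1.
  apply: (@le_trans _ _ (\sum_(0 <= i < N) 1)).
    by apply: ler_sum => i _; rewrite indicE lern1 leq_b1.
  by rewrite big_const_nat subn0 iter_addr_0.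
have FG : {ae P, forall w, B w -> (F N w)%:E @[N --> \oo] --> (G w)%:E}.
  apply: filterS aeC => w Cw _; apply: cvg_EFin; first exact: nearW.
  rewrite (_ : _ \o _ = cesaro_mean (fun i => \1_C (iter i T w) : R)); last first.
    by apply/funext => N; rewrite /= /F -mulr_sumr.
  congr (_ --> _) : Cw; apply: eq_bigr => j _; congr (_ * _).
  by rewrite /Rintegral integral_indic// setIT.
have i1 : P.-integrable B (EFin \o (fun=> 1 : R)).
  apply: (integrableS measurableT) => //.
  by apply: (@integrable_bounded_by _ _ _ _ _ 1) => // w; rewrite normr1.
have mFE N : measurable_fun B (EFin \o F N) by exact/measurable_EFinP.
have mGE : measurable_fun B (EFin \o G) by exact/measurable_EFinP.
have [|iG _ intFG] := dominated_convergence mB mFE mGE FG i1.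
  by apply: aeW => w N _; rewrite lee_fin.
have GE : \int[P]_(w in B) G w = \sum_(j < n) fine (Q j C) * fine (P (A j `&` B)).
  exact: Rintegral_sum_indic.
have FE N : \int[P]_(w in B) F N w =
    cesaro_mean (fun i => fine (P (B `&` iter i T @^-1` C))) N.
  rewrite Rintegral_sum_indic// /cesaro_mean mulr_sumr.
  by apply: eq_bigr => i _; rewrite setIC.
rewrite -GE (_ : cesaro_mean _ = fun N => \int[P]_(w in B) F N w); last first.
  by apply/funext => N; rewrite FE.
apply: fine_cvg; rewrite fineK//; exact: integrable_fin_num.
Qed.

Lemma finite_invariant_values :
  (forall j, ergodic_probabilities T (Q j)) ->
  (forall B C : set Omega, measurable B -> measurable C ->
    cesaro_mean (fun i => fine (P (B `&` iter i T @^-1` C))) @ \oo -->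
    \sum_(j < n) fine (Q j C) * fine (P (A j `&` B))) ->
  finite_set (P @` invariant_sets T).
Proof.
move=> ergQ cvgP.
(* The vector [b] records which [Q j] give an invariant set full measure; finitely many vectors
   leave finitely many values. *)
pose v (b : {ffun 'I_n -> bool}) := (\sum_(j < n) (b j)%:R * fine (P (A j)))%:E.
apply: (@sub_finite_set _ _ (v @` setT)); last first.
  exact/finite_image/finite_finset.
move=> _ [C iC <-]; have [mC _] := iC.
exists [ffun j => Q j C == 1%E] => //.
rewrite -[RHS]fineK ?fin_num_measure//; congr EFin.
(* With [B] the whole space and [C] invariant the averaged sequence is constant, so its limit is
   [P C]. *)
have := cvgP setT C measurableT mC.
rewrite (_ : (fun i => _) = fun=> fine (P C)); last first.
  by apply/funext => i; rewrite setTI invariant_sets_iter.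
move=> cvgC; rewrite -(cvg_lim _ (@cesaro_cst _ (fine (P C))))// (cvg_lim _ cvgC)//.
apply: eq_bigr => j _; rewrite setIT ffunE; congr (_ * _).
have [_ /(_ C iC)[->|->]] := ergQ j; last by rewrite eqxx.
by rewrite [_ == _](_ : _ = false)//; apply/eqP => -[/esym/eqP]; rewrite oner_eq0.
Qed.

End equivalences.

(** * The cycle of implications *)

Theorem theorem6p5 (R : realType) (d : measure_display)
    (Omega : measurableType d) (P : probability Omega R) (T : Omega -> Omega)
    (mT : measurable_fun [set: Omega] T)
    (invT : invertible_transformation T)
    (limP : forall A : set Omega, measurable A ->
      cvgn (cesaro_mean (fun i => fine (P (iter i T @^-1` A))))) :
  [<-> (* (i) *)
       finite_set (P @` invariant_sets T);
       (* (ii) *)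
       finite_irreducible_invariant_partition_assumption P T;
       (* (iii) *)
       exists (n : nat) (Q : 'I_n -> probability Omega R)
           (A : 'I_n -> set Omega),
         [/\ forall j, ergodic_probabilities T (Q j),
             measurable_partition A,
             forall j, (0 < P (A j))%E &
             forall f : Omega -> R, measurable_fun [set: Omega] f ->
               [bounded f w | w in [set: Omega]] ->
               {ae P, forall w,
                 cesaro_mean (fun i => f (iter i T w)) @ \oo -->
                 \sum_(j < n) (\int[Q j]_x f x) * \1_(A j) w}];
       (* (iv) *)
       exists (n : nat) (Q : 'I_n -> probability Omega R)
           (A : 'I_n -> set Omega),
         [/\ forall j, ergodic_probabilities T (Q j),
             measurable_partition A,
             forall j, (0 < P (A j))%E &
             forall B C : set Omega, measurable B -> measurable C ->
               cesaro_mean (fun i => fine (P (B `&` iter i T @^-1` C))) @ \oo -->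
               \sum_(j < n) fine (Q j C) * fine (P (A j `&` B))]].
Proof.
tfae.
- move=> fP; have [|||al [pal fal ial]] :=
      @finite_values_irreducible_partition _ _ _ P T setT.
  + by apply: sub_finite_set fP => _ [B [iB _] <-]; exists B.
  + by split.
  + by rewrite probability_setT.
  + by exists al.
- exact: irreducible_partition_birkhoff.
- move=> [n [Q [A [ergQ pA PA cvgf]]]]; exists n, Q, A; split=> // B C mB mC.
  have [_ mA] := pA; apply: cesaro_correlation_of_birkhoff => //.
  apply: cvgf; first exact: measurable_indic.
  exists 1; split; first exact: num_real.
  move=> x x1 w _ /=; rewrite (le_trans _ (ltW x1))// indicE.
  by case: (w \in C); rewrite ?normr1 ?normr0.
- move=> [n [Q [A [ergQ _ _ cvgP]]]]; exact: finite_invariant_values cvgP.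
Qed.
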